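(* Let $\mathcal{C}$ be a strict monoidal category and let $R$ be a D-structure on $\mathcal{C}$ such that all $R_X:X\to X$ are isomorphisms. Then $D^1(R)$, given by $D^1(R)_{X,Y}:=(R_X\otimes R_Y)R_{X\otimes Y}^{-1}=R_{X\otimes Y}^{-1}(R_X\otimes R_Y):X\otimes Y\to X\otimes Y$, is a strong twine on $\mathcal{C}$.
   Context: All monoidal categories are strict, with unit object $I$; juxtaposition of morphisms denotes composition. A D-structure on $\mathcal{C}$ is a family of natural morphisms $R_X:X\to X$ in $\mathcal{C}$ such that $R_I=\mathrm{id}_I$ and, for all objects $X,Y,Z$, $$(R_{X\otimes Y}\otimes \mathrm{id}_Z)(\mathrm{id}_X\otimes R_{Y\otimes Z})=(\mathrm{id}_X\otimes R_{Y\otimes Z})(R_{X\otimes Y}\otimes \mathrm{id}_Z).$$ The two expressions given for $D^1(R)_{X,Y}$ agree by naturality of $R$. A strong twine on $\mathcal{C}$ is a natural isomorphism $T_{U,V}:U\otimes V\to U\otimes V$ (natural in both variables) such that for all objects $U,V,W$: 1. $T_{I,I}=\mathrm{id}_I$; 2. $(T_{U,V}\otimes \mathrm{id}_W)T_{U\otimes V,W}=(\mathrm{id}_U\otimes T_{V,W})T_{U,V\otimes W}$; 3. $(T_{U,V}\otimes \mathrm{id}_W)(\mathrm{id}_U\otimes T_{V,W})=(\mathrm{id}_U\otimes T_{V,W})(T_{U,V}\otimes \mathrm{id}_W)$. *)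

(* Defs.v *)
From Stdlib Require Import ClassicalEpsilon.

Set Implicit Arguments.
Unset Strict Implicit.
Unset Printing Implicit Defensive.

(* [comp g f] is g after f, as in the juxtaposition notation "g f". *)
Record category := Category {
  Ob :> Type;
  Hom : Ob -> Ob -> Type;
  idm : forall X, Hom X X;
  comp : forall X Y Z, Hom Y Z -> Hom X Y -> Hom X Z;
  compA : forall X Y Z W (h : Hom Z W) (g : Hom Y Z) (f : Hom X Y),
    comp h (comp g f) = comp (comp h g) f;
  comp1m : forall X Y (f : Hom X Y), comp (idm Y) f = f;
  compm1 : forall X Y (f : Hom X Y), comp f (idm X) = f
}.

Arguments Hom {c} X Y.
Arguments idm {c} X.
Arguments comp {c X Y Z} g f.

Declare Scope cat_scope.
Delimit Scope cat_scope with cat.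
Open Scope cat_scope.

Notation "g ∘ f" := (comp g f) (at level 40, left associativity) : cat_scope.

(* Strictness is an equality of objects, so the two sides of an equation of
   morphisms may live in hom-sets that are equal only propositionally. *)
Definition hcast (C : category) (X X' Y Y' : C) (eX : X = X') (eY : Y = Y')
    (f : Hom X Y) : Hom X' Y' :=
  match eX in _ = A, eY in _ = B return Hom A B with
  | eq_refl, eq_refl => f
  end.

Definition is_iso (C : category) (X Y : C) (f : Hom X Y) : Prop :=
  exists g : Hom Y X, g ∘ f = idm X /\ f ∘ g = idm Y.

Definition inv (C : category) (X Y : C) (f : Hom X Y) (hf : is_iso f) :
    Hom Y X :=
  proj1_sig (constructive_indefinite_description _ hf).

Record strict_monoidal := StrictMonoidal {
  smcat :> category;
  unitI : smcat;
  tens : smcat -> smcat -> smcat;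
  tensm : forall X X' Y Y' : smcat,
    Hom X X' -> Hom Y Y' -> Hom (tens X Y) (tens X' Y');
  tensm_id : forall X Y : smcat, tensm (idm X) (idm Y) = idm (tens X Y);
  tensm_comp : forall (X X' X'' Y Y' Y'' : smcat)
    (f' : Hom X' X'') (f : Hom X X') (g' : Hom Y' Y'') (g : Hom Y Y'),
    tensm (f' ∘ f) (g' ∘ g) = tensm f' g' ∘ tensm f g;
  tensA : forall X Y Z : smcat, tens X (tens Y Z) = tens (tens X Y) Z;
  tens1l : forall X : smcat, tens unitI X = X;
  tens1r : forall X : smcat, tens X unitI = X;
  tensmA : forall (X X' Y Y' Z Z' : smcat)
    (f : Hom X X') (g : Hom Y Y') (h : Hom Z Z'),
    hcast (tensA X Y Z) (tensA X' Y' Z') (tensm f (tensm g h))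
      = tensm (tensm f g) h;
  tensm1l : forall (X X' : smcat) (f : Hom X X'),
    hcast (tens1l X) (tens1l X') (tensm (idm unitI) f) = f;
  tensm1r : forall (X X' : smcat) (f : Hom X X'),
    hcast (tens1r X) (tens1r X') (tensm f (idm unitI)) = f
}.

Arguments unitI {s}.
Arguments tens {s} X Y.
Arguments tensm {s X X' Y Y'} f g.

Notation "X ⊗ Y" := (tens X Y) (at level 38, left associativity) : cat_scope.
Notation "f ⊗m g" := (tensm f g) (at level 38, left associativity) : cat_scope.

Definition reassoc (C : strict_monoidal) (X Y Z X' Y' Z' : C)
    (f : Hom (X ⊗ (Y ⊗ Z)) (X' ⊗ (Y' ⊗ Z'))) :
    Hom (X ⊗ Y ⊗ Z) (X' ⊗ Y' ⊗ Z') :=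
  hcast (tensA X Y Z) (tensA X' Y' Z') f.

Record is_D_structure (C : strict_monoidal) (R : forall X : C, Hom X X) :
    Prop := IsDStructure {
  D_natural : forall (X Y : C) (f : Hom X Y), R Y ∘ f = f ∘ R X;
  D_unit : R unitI = idm unitI;
  D_comm : forall X Y Z : C,
    (R (X ⊗ Y) ⊗m idm Z) ∘ reassoc (idm X ⊗m R (Y ⊗ Z))
      = reassoc (idm X ⊗m R (Y ⊗ Z)) ∘ (R (X ⊗ Y) ⊗m idm Z)
}.

(* The unit axiom identifies I ⊗ I with I. *)
Record is_strong_twine (C : strict_monoidal)
    (T : forall U V : C, Hom (U ⊗ V) (U ⊗ V)) : Prop := IsStrongTwine {
  twine_natural : forall (U U' V V' : C) (f : Hom U U') (g : Hom V V'),
    T U' V' ∘ (f ⊗m g) = (f ⊗m g) ∘ T U V;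
  twine_iso : forall U V : C, is_iso (T U V);
  twine_unit : hcast (tens1l unitI) (tens1l unitI) (T unitI unitI) = idm unitI;
  twine_assoc : forall U V W : C,
    (T U V ⊗m idm W) ∘ T (U ⊗ V) W
      = reassoc ((idm U ⊗m T V W) ∘ T U (V ⊗ W));
  twine_comm : forall U V W : C,
    (T U V ⊗m idm W) ∘ reassoc (idm U ⊗m T V W)
      = reassoc (idm U ⊗m T V W) ∘ (T U V ⊗m idm W)
}.

Definition D1 (C : strict_monoidal) (R : forall X : C, Hom X X)
    (hR : forall X : C, is_iso (R X)) (X Y : C) : Hom (X ⊗ Y) (X ⊗ Y) :=
  (R X ⊗m R Y) ∘ inv (hR (X ⊗ Y)).

(* Main.v *)
(* Every morphism involved is assembled from the components of [R] and their
   inverses, and naturality makes most of them commute: [R_{U⊗V}] commutes with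
   every [f ⊗ g].  In the cocycle identity the factors [R_{U⊗V}] (respectively
   [R_{V⊗W}]) cancel, so both sides equal
   [(R_U ⊗ R_V ⊗ R_W) R_{U⊗V⊗W}^{-1}].  The commutation of [T_{U,V} ⊗ id] with
   [id ⊗ T_{V,W}] splits into four commutations: two follow from naturality, one
   from [R_V] commuting with itself, and the one between the inverses of
   [R_{U⊗V} ⊗ id] and [id ⊗ R_{V⊗W}] is the D-structure axiom. *)
Require Import Defs.
From Stdlib Require Import ClassicalEpsilon.

Section Commutation.
Context {C : category}.

Definition commutes {X : C} (f g : Hom X X) : Prop := f ∘ g = g ∘ f.

Lemma commutes_sym (X : C) (f g : Hom X X) : commutes f g -> commutes g f.
Proof. exact (fun e => eq_sym e). Qed.

Lemma commutes_idm (X : C) (f : Hom X X) : commutes f (idm X).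
Proof. unfold commutes; now rewrite comp1m, compm1. Qed.

Lemma commutes_comp (X : C) (f g h : Hom X X) :
  commutes f g -> commutes f h -> commutes f (g ∘ h).
Proof.
unfold commutes; intros fg fh.
now rewrite compA, fg, <- compA, fh, compA.
Qed.

(** Insert [p ∘ p'] to the right of [q' ∘ f], move [p] across [f], then cancel [q' ∘ q]. Allowing
    [X] and [Y] to differ makes this serve both for naturality of the inverses and for commutation
    with an inverse. *)
Lemma conj_inverse {X Y : C} {p p' : Hom X X} {q q' : Hom Y Y} {f : Hom X Y} :
  p ∘ p' = idm X -> q' ∘ q = idm Y -> q ∘ f = f ∘ p -> q' ∘ f = f ∘ p'.
Proof.
intros pp' q'q e.
rewrite <- (compm1 (q' ∘ f)), <- pp', compA, <- (compA q' f p), <- e.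
now rewrite compA, q'q, comp1m.
Qed.

Lemma commutes_inverse {X : C} {f g g' : Hom X X} :
  g ∘ g' = idm X -> g' ∘ g = idm X -> commutes f g -> commutes f g'.
Proof.
unfold commutes; intros gg' g'g fg.
exact (eq_sym (conj_inverse gg' g'g (eq_sym fg))).
Qed.

Lemma inv_l {X Y : C} {f : Hom X Y} (hf : is_iso f) : inv hf ∘ f = idm X.
Proof.
unfold inv; destruct (constructive_indefinite_description _ hf) as [g [gf fg]].
exact gf.
Qed.

Lemma inv_r {X Y : C} {f : Hom X Y} (hf : is_iso f) : f ∘ inv hf = idm Y.
Proof.
unfold inv; destruct (constructive_indefinite_description _ hf) as [g [gf fg]].
exact fg.
Qed.

Lemma hcast_comp (X X' Y Y' Z Z' : C) (eX : X = X') (eY : Y = Y') (eZ : Z = Z')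
    (g : Hom Y Z) (f : Hom X Y) :
  hcast eX eZ (g ∘ f) = hcast eY eZ g ∘ hcast eX eY f.
Proof. now destruct eX, eY, eZ. Qed.

Lemma hcast_idm (X X' : C) (e : X = X') : hcast e e (idm X) = idm X'.
Proof. now destruct e. Qed.

(** Used for the inverses of [R]: equal objects, such as two bracketings of a tensor product, carry
    the same component up to transport. Naturality of [F] is not involved. *)
Lemma hcast_family (F : forall X : C, Hom X X) (X X' : C) (e : X = X') :
  hcast e e (F X) = F X'.
Proof. now destruct e. Qed.

End Commutation.

Section Reassociation.
Context {C : strict_monoidal}.

Lemma reassoc_comp (X Y Z X' Y' Z' X'' Y'' Z'' : C)
    (g : Hom (X' ⊗ (Y' ⊗ Z')) (X'' ⊗ (Y'' ⊗ Z'')))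
    (f : Hom (X ⊗ (Y ⊗ Z)) (X' ⊗ (Y' ⊗ Z'))) :
  reassoc (g ∘ f) = reassoc g ∘ reassoc f.
Proof. apply hcast_comp. Qed.

Lemma reassoc_idm (X Y Z : C) : reassoc (idm (X ⊗ (Y ⊗ Z))) = idm (X ⊗ Y ⊗ Z).
Proof. apply hcast_idm. Qed.

Lemma reassoc_tensm (X X' Y Y' Z Z' : C)
    (f : Hom X X') (g : Hom Y Y') (h : Hom Z Z') :
  reassoc (f ⊗m (g ⊗m h)) = f ⊗m g ⊗m h.
Proof. apply tensmA. Qed.

Lemma tensm_commutes (X Y : C) (f f' : Hom X X) (g g' : Hom Y Y) :
  commutes f f' -> commutes g g' -> commutes (f ⊗m g) (f' ⊗m g').
Proof.
unfold commutes; intros ef eg.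
now rewrite <- !tensm_comp, ef, eg.
Qed.

Lemma reassoc_commutes (X Y Z : C) (f g : Hom (X ⊗ (Y ⊗ Z)) (X ⊗ (Y ⊗ Z))) :
  commutes f g -> commutes (reassoc f) (reassoc g).
Proof.
unfold commutes; intros e.
now rewrite <- !reassoc_comp, e.
Qed.

Lemma tensm_idm_comp (X Y : C) (f g : Hom Y Y) :
  idm X ⊗m (f ∘ g) = (idm X ⊗m f) ∘ (idm X ⊗m g).
Proof. now rewrite <- tensm_comp, comp1m. Qed.

Lemma tensm_comp_idm (X Y : C) (f g : Hom X X) :
  (f ∘ g) ⊗m idm Y = (f ⊗m idm Y) ∘ (g ⊗m idm Y).
Proof. now rewrite <- tensm_comp, comp1m. Qed.

End Reassociation.

Section InvertibleDStructure.
Context {C : strict_monoidal} {R : forall X : C, Hom X X}.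
Context (R_D : is_D_structure R) (R_iso : forall X : C, is_iso (R X)).

Local Notation Ri X := (inv (R_iso X)).
Local Notation T := (D1 R_iso).

(** Naturality at an endomorphism: [R X] is central in the monoid of endomorphisms of [X]. *)
Lemma commutes_R (X : C) (f : Hom X X) : commutes f (R X).
Proof. exact (eq_sym (D_natural R_D f)). Qed.

Lemma inv_natural {X Y : C} (f : Hom X Y) : Ri Y ∘ f = f ∘ Ri X.
Proof.
exact (conj_inverse (inv_r (R_iso X)) (inv_l (R_iso Y)) (D_natural R_D f)).
Qed.

Lemma commutes_Ri (X : C) (f : Hom X X) : commutes f (Ri X).
Proof. exact (eq_sym (inv_natural f)). Qed.

Lemma inv_unit : Ri unitI = idm unitI.
Proof.
rewrite <- (compm1 (Ri unitI)).
exact (eq_trans (f_equal (comp (Ri unitI)) (eq_sym (D_unit R_D))) (inv_l _)).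
Qed.

Lemma D1_natural (U U' V V' : C) (f : Hom U U') (g : Hom V V') :
  T U' V' ∘ (f ⊗m g) = (f ⊗m g) ∘ T U V.
Proof.
unfold D1.
(* The inverse at the tensor product slides past [f ⊗m g]; what remains is naturality of [R] in each
   tensor factor. *)
rewrite <- compA, inv_natural, !compA, <- !tensm_comp.
now rewrite !(D_natural R_D).
Qed.

Lemma D1_iso (U V : C) : is_iso (T U V).
Proof.
exists (R (U ⊗ V) ∘ (Ri U ⊗m Ri V)); unfold D1; split.
- rewrite (compA _ (R U ⊗m R V)), <- (compA _ (Ri U ⊗m Ri V)), <- tensm_comp.
  rewrite !inv_l, tensm_id, compm1.
  apply inv_r.
- rewrite (compA _ (R (U ⊗ V))), <- (compA _ (Ri (U ⊗ V))).
  rewrite inv_l, compm1, <- tensm_comp, !inv_r.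
  apply tensm_id.
Qed.

Lemma D1_unit : hcast (tens1l unitI) (tens1l unitI) (T unitI unitI) = idm unitI.
Proof.
unfold D1.
rewrite (D_unit R_D), tensm_id, comp1m.
(* The transport turns the inverse at [unitI ⊗ unitI] into the one at [unitI]. *)
rewrite (hcast_family (fun X => Ri X)).
apply inv_unit.
Qed.

(** By the interchange law, the inverse at [U ⊗ V] inside [T U V] meets the factor [R (U ⊗ V)] of
    [T (U ⊗ V) W]. *)
Lemma D1_assoc_l (U V W : C) :
  (T U V ⊗m idm W) ∘ T (U ⊗ V) W = (R U ⊗m R V ⊗m R W) ∘ Ri (U ⊗ V ⊗ W).
Proof.
unfold D1.
rewrite compA, <- tensm_comp, comp1m, <- (compA (R U ⊗m R V)).
now rewrite inv_l, compm1.
Qed.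

Lemma D1_assoc_r (U V W : C) :
  (idm U ⊗m T V W) ∘ T U (V ⊗ W)
    = (R U ⊗m (R V ⊗m R W)) ∘ Ri (U ⊗ (V ⊗ W)).
Proof.
unfold D1.
rewrite compA, <- tensm_comp, comp1m, <- (compA (R V ⊗m R W)).
now rewrite inv_l, compm1.
Qed.

Lemma D1_assoc (U V W : C) :
  (T U V ⊗m idm W) ∘ T (U ⊗ V) W = reassoc ((idm U ⊗m T V W) ∘ T U (V ⊗ W)).
Proof.
rewrite D1_assoc_l, D1_assoc_r, reassoc_comp, reassoc_tensm.
unfold reassoc.
now rewrite (hcast_family (fun X => Ri X)).
Qed.

(** Starting from [D_comm], each of the two factors is replaced by its inverse in turn. *)
Lemma Ri_tens_commutes (U V W : C) :
  commutes (Ri (U ⊗ V) ⊗m idm W) (reassoc (idm U ⊗m Ri (V ⊗ W))).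
Proof.
apply (@commutes_inverse _ _ _ (reassoc (idm U ⊗m R (V ⊗ W)))).
- now rewrite <- reassoc_comp, <- tensm_idm_comp, inv_r, tensm_id, reassoc_idm.
- now rewrite <- reassoc_comp, <- tensm_idm_comp, inv_l, tensm_id, reassoc_idm.
- apply commutes_sym, (@commutes_inverse _ _ _ (R (U ⊗ V) ⊗m idm W)).
  + now rewrite <- tensm_comp_idm, inv_r, tensm_id.
  + now rewrite <- tensm_comp_idm, inv_l, tensm_id.
  + apply commutes_sym, (D_comm R_D).
Qed.

Lemma D1_comm (U V W : C) :
  commutes (T U V ⊗m idm W) (reassoc (idm U ⊗m T V W)).
Proof.
unfold D1.
rewrite tensm_idm_comp, reassoc_comp, tensm_comp_idm.
(* Each side is now a product of two factors, which leaves one goal for each pair. *)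
apply commutes_comp; apply commutes_sym, commutes_comp; apply commutes_sym.
- rewrite reassoc_tensm.
  apply tensm_commutes; [apply tensm_commutes|].
  + apply commutes_idm.
  + apply commutes_R.
  + apply commutes_sym, commutes_idm.
- rewrite reassoc_tensm.
  apply tensm_commutes.
  + apply commutes_sym, commutes_Ri.
  + apply commutes_sym, commutes_idm.
(* Bracketing to the right makes [R V ⊗m idm W] a single endomorphism of [V ⊗ W], with which the
   inverse at [V ⊗ W] commutes. *)
- rewrite <- reassoc_tensm.
  apply reassoc_commutes, tensm_commutes.
  + apply commutes_idm.
  + apply commutes_Ri.
- apply Ri_tens_commutes.
Qed.

End InvertibleDStructure.

Theorem proposition2p11 (C : strict_monoidal) (R : forall X : C, Hom X X)
    (R_D : is_D_structure R) (R_iso : forall X : C, is_iso (R X)) :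
  (forall X Y : C, D1 R_iso X Y = inv (R_iso (X ⊗ Y)) ∘ (R X ⊗m R Y))
  /\ is_strong_twine (D1 R_iso).
Proof.
split.
- intros X Y; apply (commutes_Ri R_D).
- split.
  + exact (D1_natural R_D R_iso).
  + exact (D1_iso R_iso).
  + exact (D1_unit R_D R_iso).
  + exact (D1_assoc R_iso).
  + exact (D1_comm R_D R_iso).
Qed.
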